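(* The function $\varphi$ takes rational values at each dyadic point; that is, $\varphi(q/2^n)\in\mathbb{Q}$ for every integer $q$ and every integer $n\ge 0$.
   Context: $\varphi\colon\mathbb{R}\to\mathbb{R}$ denotes the unique infinitely differentiable function with compact support such that $\operatorname{supp}(\varphi)=[-1,1]$, $\varphi(t)>0$ for all $t\in(-1,1)$, $\varphi(0)=1$, and $\varphi'(t)=2\bigl(\varphi(2t+1)-\varphi(2t-1)\bigr)$ for all $t\in\mathbb{R}$. *)

(* Defs.v *)
(* Stdlib real numbers with Coquelicot. *)
From Stdlib Require Export Reals QArith Qreals.
From Coquelicot Require Export Coquelicot.
Open Scope R_scope.

Definition support (f : R -> R) : R -> Prop :=
  adherence (fun t => f t <> 0).

Definition smooth (f : R -> R) : Prop :=
  forall (n : nat) (t : R), ex_derive_n f n t.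

(* The atomic function determined by these conditions.  Compactness follows
   from [up_supp]. *)
Record is_up (phi : R -> R) : Prop := {
  up_smooth : smooth phi;
  up_compact : compact (support phi);
  up_supp : forall t : R, support phi t <-> -1 <= t <= 1;
  up_pos : forall t : R, -1 < t < 1 -> 0 < phi t;
  up_0 : phi 0 = 1;
  up_derive : forall t : R,
    Derive phi t = 2 * (phi (2 * t + 1) - phi (2 * t - 1))
}.

(* Main.v *)
Require Import Defs.
From Stdlib Require Import Reals QArith Qreals Wf_nat Factorial Lra Lia.
From Coquelicot Require Import Coquelicot.
Open Scope R_scope.

(** Write [phi_k] for the [k]-fold antiderivative of [phi] that vanishes on
    the left of the support.  The functional equation says that [phi t] and
    [phi_1 (2 t + 1) - phi_1 (2 t - 1)] have the same derivative, and both
    vanish far to the left, so they are equal.  Integrating this [k] times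
    gives

      [2^k phi_k t = phi_(k+1) (2 t + 1) - phi_(k+1) (2 t - 1)]

    ([iterint_refine]): the values of all the antiderivatives at [t] are
    rational combinations of their values at [2 t + 1] and [2 t - 1].
    Since these two arguments have one factor 2 less in their denominator
    than [t], the theorem reduces to the rationality of the antiderivatives
    at odd integers ([iterint_rational_dyadic]).

    Left of the support the antiderivatives are 0.  Right of it [phi_k] is a
    polynomial, whose Taylor coefficients at 1 are the values [phi_j 1] with
    [1 <= j <= k], up to factorials ([iterint_Taylor]).  So only the numbers
    [phi_k 1] remain, which are essentially the moments of [phi].  The first
    one is 1, because [1 = phi 0 = phi_1 1 - phi_1 (-1)].  For [k >= 2] the
    refinement equation at [t = 1] relates [phi_k 1] to
    [phi_(k+1) 3 - phi_(k+1) 1]; expanding [phi_(k+1) 3] in Taylor form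
    cancels [phi_(k+1) 1] and leaves [(2^k - 2) phi_k 1] equal to a rational
    combination of the [phi_j 1] with [j < k] ([iterint_rational_1]). *)

(** * Rational real numbers *)

Definition rational (x : R) : Prop := exists r : Q, x = Q2R r.

Lemma rational_IZR (z : Z) : rational (IZR z).
Proof. exists (inject_Z z). unfold Q2R; simpl; field. Qed.

Lemma rational_plus (x y : R) : rational x -> rational y -> rational (x + y).
Proof. intros [a ->] [b ->]. exists (a + b)%Q. now rewrite Q2R_plus. Qed.

Lemma rational_minus (x y : R) : rational x -> rational y -> rational (x - y).
Proof. intros [a ->] [b ->]. exists (a - b)%Q. now rewrite Q2R_minus. Qed.

Lemma rational_mult (x y : R) : rational x -> rational y -> rational (x * y).
Proof. intros [a ->] [b ->]. exists (a * b)%Q. now rewrite Q2R_mult. Qed.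

Lemma rational_inv (x : R) : rational x -> rational (/ x).
Proof.
intros [a ->].
destruct (Qeq_dec a 0) as [Ha | Ha].
- exists 0%Q. rewrite (Qeq_eqR _ _ Ha), RMicromega.Q2R_0. apply Rinv_0.
- exists (/ a)%Q. now rewrite Q2R_inv.
Qed.

Lemma rational_div (x y : R) : rational x -> rational y -> rational (x / y).
Proof. intros Hx Hy. apply rational_mult; [exact Hx | now apply rational_inv]. Qed.

Lemma rational_INR (n : nat) : rational (INR n).
Proof. rewrite INR_IZR_INZ. apply rational_IZR. Qed.

Lemma rational_pow (x : R) (n : nat) : rational x -> rational (x ^ n).
Proof.
intros Hx; induction n as [|n IH]; simpl.
- apply (rational_IZR 1).
- now apply rational_mult.
Qed.

Lemma rational_sum (u : nat -> R) (n : nat) :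
  (forall i, (i <= n)%nat -> rational (u i)) -> rational (sum_f_R0 u n).
Proof.
induction n as [|n IH]; intros Hu; simpl.
- now apply Hu.
- apply rational_plus; [apply IH; intros i Hi|]; apply Hu; lia.
Qed.

(** * Iterated antiderivatives *)

(** The base point -1 is the left end of the support of the functions of
    interest, so that all the antiderivatives vanish to the left of it. *)
Fixpoint iterint (f : R -> R) (k : nat) (t : R) : R :=
  match k with
  | O => f t
  | S k' => RInt (iterint f k') (-1) t
  end.

Lemma is_derive_RInt_continuous (f : R -> R) (a t : R) :
  (forall s, continuous f s) -> is_derive (fun s => RInt f a s) t (f t).
Proof.
intros Hf. apply is_derive_RInt with a; [|apply Hf].
apply filter_forall; intros s.
apply (RInt_correct (V := R_CompleteNormedModule)). apply (ex_RInt_continuous (V := R_CompleteNormedModule)); intros z _; apply Hf.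
Qed.

Lemma iterint_continuous (f : R -> R) (k : nat) :
  (forall t, continuous f t) -> forall t, continuous (iterint f k) t.
Proof.
intros Hf; induction k as [|k IH]; [exact Hf|]; intros t.
apply (ex_derive_continuous (V := R_NormedModule)). eexists; now apply is_derive_RInt_continuous.
Qed.

Lemma is_derive_iterint (f : R -> R) (k : nat) (t : R) :
  (forall s, continuous f s) ->
  is_derive (iterint f (S k)) t (iterint f k t).
Proof.
intros Hf. apply is_derive_RInt_continuous. now apply iterint_continuous.
Qed.

Lemma Derive_n_iterint (f : R -> R) (m k : nat) (t : R) :
  (forall s, continuous f s) -> (m <= k)%nat ->
  Derive_n (iterint f k) m t = iterint f (k - m) t.
Proof.
intros Hf; revert t; induction m as [|m IH]; intros t Hm; simpl.
- now rewrite Nat.sub_0_r.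
- rewrite (Derive_ext _ (iterint f (S (k - S m)))).
  + apply is_derive_unique. now apply is_derive_iterint.
  + intros s. rewrite IH by lia. f_equal; lia.
Qed.

Lemma ex_derive_n_iterint (f : R -> R) (m k : nat) (t : R) :
  (forall s, continuous f s) -> (m <= k)%nat ->
  ex_derive_n (iterint f k) m t.
Proof.
intros Hf Hm; destruct m as [|m]; [exact I|]; simpl.
apply ex_derive_ext with (iterint f (S (k - S m))).
- intros s. rewrite Derive_n_iterint by (trivial; lia). f_equal; lia.
- eexists; now apply is_derive_iterint.
Qed.

Lemma iterint_left (f : R -> R) (k : nat) (t : R) :
  (forall s, s < -1 -> f s = 0) -> t < -1 -> iterint f k t = 0.
Proof.
intros Hf; revert t; induction k as [|k IH]; intros t Ht; [now apply Hf|].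
simpl. rewrite (RInt_ext _ (fun _ => 0)).
- rewrite RInt_const. apply Rmult_0_r.
- intros s. rewrite Rmax_left by lra. intros [_ Hs]. now apply IH.
Qed.

Lemma iterint_base (f : R -> R) (k : nat) : iterint f (S k) (-1) = 0.
Proof. exact (RInt_point (V := R_CompleteNormedModule) _ _). Qed.

(** The Lagrange remainder of the Taylor formula involves a value of [f] to
    the right of 1, so it is zero. *)
Lemma iterint_Taylor (f : R -> R) (n : nat) (x : R) :
  (forall s, continuous f s) -> (forall s, 1 < s -> f s = 0) -> 1 < x ->
  iterint f (S n) x =
  sum_f_R0 (fun m => (x - 1) ^ m / INR (fact m) * iterint f (S n - m) 1) n.
Proof.
intros Hf H1 Hx.
destruct (Taylor_Lagrange (iterint f (S n)) n 1 x Hx) as [z [Hz ->]].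
{ intros t _ k Hk. now apply ex_derive_n_iterint. }
rewrite (Derive_n_iterint f (S n) (S n)) by trivial.
rewrite Nat.sub_diag. simpl iterint at 2. rewrite H1 by lra.
rewrite Rmult_0_r, Rplus_0_r.
apply sum_eq; intros i Hi. rewrite Derive_n_iterint by (trivial; lia).
reflexivity.
Qed.

(** * The refinement equation *)

Lemma eq_of_Derive_eq (f g df : R -> R) (a t : R) :
  (forall s, is_derive f s (df s)) -> (forall s, is_derive g s (df s)) ->
  f a = g a -> f t = g t.
Proof.
intros Hf Hg Ha.
assert (H0 : forall s, is_derive (fun s : R => f s - g s) s 0).
{ intros s. replace 0 with (df s - df s) by ring.
  now apply (is_derive_minus (V := R_NormedModule)). }
assert (H : f t - g t = f a - g a); [|lra].
destruct (Rtotal_order a t) as [Hat | [-> | Hat]].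
- symmetry. apply (eq_is_derive (V := R_NormedModule) (fun s => f s - g s) a t); auto.
- reflexivity.
- apply (eq_is_derive (V := R_NormedModule) (fun s => f s - g s) t a); auto.
Qed.

Lemma up_derivable (phi : R -> R) (t : R) : is_up phi -> ex_derive phi t.
Proof. intros H. apply (up_smooth _ H 1%nat t). Qed.

Lemma up_continuous (phi : R -> R) (t : R) : is_up phi -> continuous phi t.
Proof. intros H. apply (ex_derive_continuous (V := R_NormedModule)). now apply up_derivable. Qed.

Lemma up_outside (phi : R -> R) (t : R) :
  is_up phi -> t < -1 \/ 1 < t -> phi t = 0.
Proof.
intros H Ht. destruct (Req_dec (phi t) 0) as [H0 | H0]; [exact H0|].
exfalso. enough (-1 <= t <= 1) by lra.
apply (up_supp _ H). now apply adherence_P1.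
Qed.

Lemma is_derive_affine_diff (F f : R -> R) (c t : R) :
  (forall s, is_derive F s (f s)) ->
  is_derive (fun s => c * (F (2 * s + 1) - F (2 * s - 1))) t
    (2 * c * (f (2 * t + 1) - f (2 * t - 1))).
Proof.
intros HF.
assert (HD : forall s, Derive F s = f s) by (intros s; now apply is_derive_unique).
auto_derive.
- repeat split; eexists; apply HF.
- rewrite !HD.
  replace (2 * t + - (1)) with (2 * t - 1) by ring. ring.
Qed.

(** Both sides have the same derivative, by the functional equation for
    [k = 0] and by induction otherwise, and both vanish at -2, since -2, -3
    and -5 are to the left of the support. *)
Lemma iterint_refine (phi : R -> R) (k : nat) (t : R) :
  is_up phi ->
  iterint phi k t =
  / 2 ^ k * (iterint phi (S k) (2 * t + 1) - iterint phi (S k) (2 * t - 1)).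
Proof.
intros H.
assert (Hc : forall s, continuous phi s) by (intros; now apply up_continuous).
assert (Hl : forall j s, s < -1 -> iterint phi j s = 0).
{ intros j s. apply iterint_left. intros; apply up_outside; auto. }
revert t; induction k as [|k IH]; intros t.
- apply (eq_of_Derive_eq (iterint phi 0)
    (fun s => / 2 ^ 0 * (iterint phi 1 (2 * s + 1) - iterint phi 1 (2 * s - 1)))
    (fun s => 2 * / 2 ^ 0 * (phi (2 * s + 1) - phi (2 * s - 1))) (-2) t).
  + intros s.
    replace (2 * / 2 ^ 0 * (phi (2 * s + 1) - phi (2 * s - 1)))
      with (Derive phi s) by (rewrite (up_derive _ H); simpl; field).
    now apply Derive_correct, up_derivable.
  + intros s. apply is_derive_affine_diff; intros; now apply is_derive_iterint.
  + rewrite !Hl by lra; ring.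
- apply (eq_of_Derive_eq (iterint phi (S k))
    (fun s => / 2 ^ S k *
       (iterint phi (S (S k)) (2 * s + 1) - iterint phi (S (S k)) (2 * s - 1)))
    (iterint phi k) (-2) t).
  + intros s. now apply is_derive_iterint.
  + intros s. rewrite IH.
    replace (/ 2 ^ k) with (2 * / 2 ^ S k)
      by (simpl; field; now apply pow_nonzero).
    apply is_derive_affine_diff; intros; now apply is_derive_iterint.
  + rewrite !Hl by lra; ring.
Qed.

(** * Rationality at dyadic points *)

Lemma iterint_1_1 (phi : R -> R) : is_up phi -> iterint phi 1 1 = 1.
Proof.
intros H. rewrite <- (up_0 _ H) at 2.
change (phi 0) with (iterint phi 0 0). rewrite (iterint_refine phi 0 0 H).
replace (2 * 0 + 1) with 1 by ring. replace (2 * 0 - 1) with (-1) by ring.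
rewrite iterint_base. simpl pow. field.
Qed.

(** The refinement equation at 1 involves the values at 3 and 1, and the
    Taylor expansion at 1 of the value at 3 turns it into the linear equation
    [HE] for [iterint phi (S (S n)) 1] in terms of lower antiderivatives. *)
Lemma iterint_rational_1 (phi : R -> R) (k : nat) :
  is_up phi -> rational (iterint phi (S k) 1).
Proof.
intros H.
induction k as [[|n] IH] using lt_wf_ind.
{ rewrite iterint_1_1 by exact H. apply (rational_IZR 1). }
pose (u := fun m => 2 ^ m / INR (fact m) * iterint phi (S (S (S n)) - m) 1).
assert (HT : iterint phi (S (S (S n))) 3 =
  iterint phi (S (S (S n))) 1 + 2 * iterint phi (S (S n)) 1
  + sum_f_R0 (fun i => u (S (S i))) n).
{ rewrite iterint_Taylor; [|intros; now apply up_continuous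
                           |intros; apply up_outside; auto | lra].
  replace (3 - 1) with 2 by ring. fold u.
  rewrite decomp_sum by lia. rewrite decomp_sum by (simpl; lia).
  unfold u at 1 2. simpl Nat.pred. simpl Nat.sub. simpl fact. simpl INR.
  simpl pow. field. }
pose proof (iterint_refine phi (S (S n)) 1 H) as HR.
replace (2 * 1 + 1) with 3 in HR by ring.
replace (2 * 1 - 1) with 1 in HR by ring.
rewrite HT in HR.
assert (Hp : 2 < 2 ^ S (S n)).
{ pose proof (pow_R1_Rle 2 n ltac:(lra)). simpl. lra. }
assert (HE : (2 ^ S (S n) - 2) * iterint phi (S (S n)) 1
             = sum_f_R0 (fun i => u (S (S i))) n).
{ rewrite Rmult_minus_distr_r. rewrite HR at 1. field. lra. }
replace (iterint phi (S (S n)) 1)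
  with (sum_f_R0 (fun i => u (S (S i))) n / (2 ^ S (S n) - 2))
  by (rewrite <- HE; field; lra).
apply rational_div.
- apply rational_sum; intros i Hi. unfold u. apply rational_mult.
  + apply rational_div; [apply rational_pow, (rational_IZR 2)|].
    apply rational_INR.
  + replace (S (S (S n)) - S (S i))%nat with (S (n - i)) by lia.
    apply IH; lia.
- apply rational_minus; [apply rational_pow|]; apply (rational_IZR 2).
Qed.

Lemma iterint_rational_nonzero (phi : R -> R) (z : Z) (k : nat) :
  is_up phi -> z <> 0%Z -> rational (iterint phi (S k) (IZR z)).
Proof.
intros H Hz.
assert (Hcases : (z < -1 \/ z = -1 \/ z = 1 \/ 1 < z)%Z) by lia.
destruct Hcases as [Hl | [-> | [-> | Hr]]].
- apply IZR_lt in Hl. rewrite iterint_left; [apply (rational_IZR 0)| |exact Hl].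
  intros; apply up_outside; auto.
- rewrite iterint_base. apply (rational_IZR 0).
- now apply iterint_rational_1.
- apply IZR_lt in Hr.
  rewrite iterint_Taylor; [|intros; now apply up_continuous
                           |intros; apply up_outside; auto | exact Hr].
  apply rational_sum; intros i Hi. apply rational_mult.
  + apply rational_div; [apply rational_pow|apply rational_INR].
    apply rational_minus; [apply rational_IZR | apply (rational_IZR 1)].
  + replace (S k - i)%nat with (S (k - i)) by lia. now apply iterint_rational_1.
Qed.

Lemma iterint_rational_step (phi : R -> R) (k : nat) (t : R) :
  is_up phi ->
  rational (iterint phi (S k) (2 * t + 1)) ->
  rational (iterint phi (S k) (2 * t - 1)) ->
  rational (iterint phi k t).
Proof.
intros H Hp Hm. rewrite iterint_refine by exact H. apply rational_mult.
- apply rational_inv, rational_pow, (rational_IZR 2).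
- now apply rational_minus.
Qed.

(** The integers need a step of their own: 0 lies inside the support, but
    the refinement equation at an integer only involves odd integers. *)
Lemma iterint_rational_dyadic (phi : R -> R) (q : Z) (n k : nat) :
  is_up phi -> rational (iterint phi k (IZR q / 2 ^ n)).
Proof.
intros H; revert q k; induction n as [|n IH]; intros q k.
- simpl pow. rewrite Rdiv_1_r.
  apply iterint_rational_step; [exact H | |].
  + rewrite <- mult_IZR, <- plus_IZR. apply iterint_rational_nonzero; [exact H|lia].
  + rewrite <- mult_IZR, <- minus_IZR. apply iterint_rational_nonzero; [exact H|lia].
- assert (H2 : 2 ^ n <> 0) by (apply pow_nonzero; lra).
  apply iterint_rational_step; [exact H | |].
  + replace (2 * (IZR q / 2 ^ S n) + 1) with (IZR (q + 2 ^ Z.of_nat n) / 2 ^ n).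
    * apply IH.
    * rewrite plus_IZR, <- pow_IZR. simpl. field. exact H2.
  + replace (2 * (IZR q / 2 ^ S n) - 1) with (IZR (q - 2 ^ Z.of_nat n) / 2 ^ n).
    * apply IH.
    * rewrite minus_IZR, <- pow_IZR. simpl. field. exact H2.
Qed.

Theorem theorem7 (phi : R -> R) (hphi : is_up phi) (q : Z) (n : nat) :
  exists r : Q, phi (IZR q / 2 ^ n) = Q2R r.
Proof. exact (iterint_rational_dyadic phi q n 0 hphi). Qed.
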